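(* Let $n\ge 1$, $l\ge 1$ be integers, let $m_1,\dots,m_l\ge 2$ be distinct integers, let $\alpha_1,\dots,\alpha_l\in\mathbb{R}$, $p\in(0,1)$, and let $f:\{0,1\}^n\to\mathbb{R}$ be the subgraph counting function $$f(X)=n\left(\sum_{q=1}^{l}\frac{\alpha_q}{n^{m_q}}\sum_{i_1\neq\dots\neq i_{m_q}}X_{i_1}\cdots X_{i_{m_q}}\right)+\log\left(\frac{p}{1-p}\right)\|X\|_1 .$$ Let $X_n^f$ be the random vector in $\{0,1\}^n$ with $\mathbb{P}(X_n^f=X)=\exp(f(X))/Z$, where $Z$ is the normalizing constant. Let $$C_\alpha=\max\left\{2,\ \frac12\left|\log\left(\frac{p}{1-p}\right)\right|+\frac12\sum_{q=1}^{l}|\alpha_q|m_q(m_q-1)\right\}$$ and $$\mathcal{X}_f=\left\{X\in[0,1]^n:\ \left\|X-\frac{\mathbf{1}_n+\tanh(\nabla f(X))}{2}\right\|_1\le 5000\,C_\alpha^2\,n^{7/8}\right\}.$$ Then there exists a probability measure $\rho$ on $[0,1]^n$, depending on $n$ and $f$, such that $X_n^f$ is a $\left(\rho,\,80\,C_\alpha^{1/4}n^{-1/8}\right)$-mixture and $$\rho(\mathcal{X}_f)\ge 1-80\,C_\alpha^{1/4}n^{-1/8}.$$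
   Context: Sums over $i_1\neq\dots\neq i_m$ run over all ordered $m$-tuples of pairwise distinct indices in $[n]=\{1,\dots,n\}$. $\|\cdot\|_1$ is the $1$-norm on $\mathbb{R}^n$, $\mathbf{1}_n$ is the all-ones vector, and $\tanh$ is applied entrywise. Discrete gradient: $\nabla f(X)=(\partial_1 f(X),\dots,\partial_n f(X))$, where for $X\in\{0,1\}^n$, $\partial_j f(X)=\frac12\big(f(X_1,\dots,X_{j-1},1,X_{j+1},\dots,X_n)-f(X_1,\dots,X_{j-1},0,X_{j+1},\dots,X_n)\big)$; for $X\in[0,1]^n$ it is extended by the formula $$\partial_j f(X)=\frac12\log\left(\frac{p}{1-p}\right)+\sum_{q=1}^{l}\frac{m_q\alpha_q}{2n^{m_q-1}}C_j^{m_q}(X),\qquad C_j^{m}(X)=\sum_{j\neq i_1\neq\dots\neq i_{m-1}}X_{i_1}\cdots X_{i_{m-1}},$$ the last sum being over ordered tuples of pairwise distinct indices all different from $j$. Mixtures: for $\mathbf{p}\in[0,1]^n$, $G(n,\mathbf{p})$ is the random vector in $\{0,1\}^n$ (vertex-weight configuration) with independent coordinates, the $i$-th being $1$ with probability $\mathbf{p}_i$ and $0$ otherwise (an edge $\{i,j\}$ is present when the product of the weights of $i$ and $j$ is $1$, hence with probability $\mathbf{p}_i\mathbf{p}_j$). For a probability measure $\rho$ on $[0,1]^n$, $G(n,\rho)$ is the random configuration with $\mathbb{P}(G(n,\rho)=G)=\int\mathbb{P}(G(n,\mathbf{p})=G)\,d\rho(\mathbf{p})$. A random configuration $G$ is a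 $(\rho,\delta)$-mixture if there exists a coupling of $G(n,\rho)$ and $G$ with $\mathbb{E}\|G(n,\rho)-G\|_1\le\delta n$. *)

(* Defs.v *)
From HB Require Import structures.
From mathcomp Require Import all_boot all_order all_algebra all_fingroup.
From mathcomp Require Import all_classical all_reals all_analysis.
From mathcomp Require Import measurable_realfun ring lra.

Set Implicit Arguments.
Unset Strict Implicit.
Unset Printing Implicit Defensive.
Import Order.TTheory GRing.Theory Num.Theory.
Import numFieldNormedType.Exports.
Local Open Scope classical_set_scope.
Local Open Scope ring_scope.

(* Points of R^n are n.-tuple (measurableTypeR R), which carry the product of
   the Borel sigma-algebras; configurations are n.-tuple bool. *)
Notation config n := (n.-tuple bool).
Notation vec R n := (n.-tuple (measurableTypeR R)).

Definition tanh {R : realType} (t : R) : R :=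
  (expR t - expR (- t)) / (expR t + expR (- t)).

Definition l1norm {R : realType} {n : nat} (x : 'I_n -> R) : R :=
  \sum_(i < n) `|x i|.

Definition weight {R : realType} {n : nat} (X : config n) : vec R n :=
  [tuple (tnth X i)%:R | i < n].

Definition unit_cube (R : realType) (n : nat) : set (vec R n) :=
  [set x | forall i, 0 <= tnth x i <= 1].
Arguments unit_cube : clear implicits.

Definition distinct_sum {R : realType} {n : nat} (m : nat) (x : vec R n) : R :=
  \sum_(t : m.-tuple 'I_n | uniq t) \prod_(i <- t) tnth x i.

(* C_j^m: the tuples have m.-1 entries, and uniq (j :: t) says that these are
   pairwise distinct and different from j. *)
Definition punctured_sum {R : realType} {n : nat} (m : nat) (j : 'I_n)
    (x : vec R n) : R :=
  \sum_(t : (m.-1).-tuple 'I_n | uniq (j :: t)) \prod_(i <- t) tnth x i.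

Definition subgraph_count {R : realType} {l : nat} (n : nat)
    (m : 'I_l -> nat) (alpha : 'I_l -> R) (p : R) (X : config n) : R :=
  n%:R * (\sum_(q < l) alpha q / n%:R ^+ m q * distinct_sum (m q) (weight X))
  + ln (p / (1 - p)) * l1norm (tnth (weight X)).

Arguments subgraph_count {R l} n m alpha p X.

(* On [0,1]^n the gradient of subgraph_count is defined by this formula; on
   {0,1}^n it is the discrete gradient, see grad_weight below. *)
Definition grad {R : realType} {l : nat} (n : nat)
    (m : 'I_l -> nat) (alpha : 'I_l -> R) (p : R) (x : vec R n) (j : 'I_n) : R :=
  2^-1 * ln (p / (1 - p))
  + \sum_(q < l) (m q)%:R * alpha q / (2 * n%:R ^+ (m q).-1)
                 * punctured_sum (m q) j x.

Arguments grad {R l} n m alpha p x j.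

Definition set_coord {n : nat} (X : config n) (j : 'I_n) (b : bool) : config n :=
  [tuple if i == j then b else tnth X i | i < n].

Definition discrete_grad {R : realType} {n : nat} (f : config n -> R)
    (X : config n) (j : 'I_n) : R :=
  2^-1 * (f (set_coord X j true) - f (set_coord X j false)).

Lemma sum_distinct_insert (R : realType) (n m : nat) (j : 'I_n)
    (g g1 g0 : 'I_n -> R) :
  (forall i, g1 i = if i == j then 1 else g i) ->
  (forall i, g0 i = if i == j then 0 else g i) ->
  \sum_(t : m.+1.-tuple 'I_n | uniq t) \prod_(i <- t) g1 i
  - \sum_(t : m.+1.-tuple 'I_n | uniq t) \prod_(i <- t) g0 i
  = m.+1%:R * \sum_(s : m.-tuple 'I_n | uniq (j :: s)) \prod_(i <- s) g i.
Proof.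
move=> g1E g0E.
pose A k := \sum_(t : m.+1.-tuple 'I_n | uniq t && (tnth t k == j))
              \prod_(i <- t) g1 i.
transitivity (\sum_(k < m.+1) A k).
  rewrite -sumrB /A; under [RHS]eq_bigr do rewrite big_mkcondr.
  rewrite exchange_big/=; apply: eq_bigr => t ut.
  rewrite -big_mkcond/= sumr_const.
  have -> : #|[pred k | tnth t k == j]| = (j \in (t : seq _)).
    rewrite -(count_uniq_mem j ut) -sum1_card -sum1_count big_tuple.
    by apply: eq_bigl => k; rewrite inE.
  case: (boolP (j \in (t : seq _))) => jt.
    rewrite mulr1n [X in _ - X](_ : _ = 0) ?subr0//.
    by apply/eqP; rewrite prodf_seq_eq0; apply/hasP; exists j; rewrite //= g0E eqxx.
  rewrite mulr0n; apply/eqP; rewrite subr_eq0; apply/eqP.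
  rewrite !big_seq; apply: eq_bigr => i it; rewrite g0E g1E.
  by case: eqP => // ij; rewrite -ij it in jt.
have AE k : A k = A ord0.
  pose h (t : m.+1.-tuple 'I_n) := [tuple tnth t (tperm ord0 k i) | i < m.+1].
  have hK : cancel h h.
    by move=> t; apply: eq_from_tnth => i; rewrite !tnth_mktuple tpermK.
  have hp t : perm_eq (h t) t by apply/tuple_permP; exists (tperm ord0 k).
  rewrite /A (reindex_inj (can_inj hK)); apply: eq_big => t.
    by rewrite (perm_uniq (hp t)) tnth_mktuple tpermR.
  by move=> _; rewrite (perm_big _ (hp t)).
under eq_bigr do rewrite AE.
rewrite sumr_const card_ord -[LHS]mulr_natl; congr (_ * _); rewrite /A.
rewrite (reindex_onto (fun s : m.-tuple 'I_n => [tuple of j :: s])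
   (fun t => [tuple of behead t])); last first.
  move=> t /andP[_ /eqP <-]; apply/val_inj => /=.
  by case/tupleP: t => x t /=; rewrite tnth0.
apply: eq_big => [s|s /andP[/andP[/= /andP[js _] _] _]].
  rewrite tnth0 eqxx andbT; apply: andb_idr => _.
  by apply/eqP/val_inj.
rewrite /= big_cons g1E eqxx mul1r !big_seq; apply: eq_bigr => i it.
by rewrite g1E; case: eqP => // ij; rewrite -ij it in js.
Qed.

Lemma grad_weight (R : realType) (n l : nat) (m : 'I_l -> nat)
    (alpha : 'I_l -> R) (p : R) (X : config n) (j : 'I_n) :
  (forall q, (0 < m q)%N) ->
  grad n m alpha p (weight X) j = discrete_grad (subgraph_count n m alpha p) X j.
Proof.
move=> m_gt0.
have n_neq0 : n%:R != 0 :> R.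
  by rewrite pnatr_eq0 -lt0n (leq_trans _ (ltn_ord j)).
have wE b i : tnth (weight (set_coord X j b) : vec R n) i =
    if i == j then b%:R else tnth (weight X) i.
  by rewrite !tnth_mktuple; case: eqP.
have normE : l1norm (tnth (weight (set_coord X j true) : vec R n)) =
    1 + l1norm (tnth (weight (set_coord X j false) : vec R n)).
  rewrite /l1norm (bigD1 j)//= [in RHS](bigD1 j)//= !wE eqxx normr1 normr0 add0r.
  by congr (_ + _); apply: eq_bigr => i /negPf ij; rewrite !wE ij.
rewrite /discrete_grad /subgraph_count normE.
set S1 := \sum_(q < l) _; set S0 := \sum_(q < l) _.
have -> : n%:R * S1 + ln (p / (1 - p)) * (1 + l1norm (tnth (weight (set_coord X j false))))
   - (n%:R * S0 + ln (p / (1 - p)) * l1norm (tnth (weight (set_coord X j false))))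
   = ln (p / (1 - p)) + n%:R * (S1 - S0) by ring.
rewrite mulrDr /grad; congr (_ + _).
rewrite /S1 /S0 -sumrB !mulr_sumr; apply: eq_bigr => q _.
rewrite -mulrBr /distinct_sum /punctured_sum.
case: (m q) (m_gt0 q) => // k _ /=.
rewrite (sum_distinct_insert k (wE true) (wE false)) exprS.
by field; rewrite expf_neq0.
Qed.

Definition C_alpha {R : realType} {l : nat}
    (m : 'I_l -> nat) (alpha : 'I_l -> R) (p : R) : R :=
  Num.max 2 (2^-1 * `|ln (p / (1 - p))|
             + 2^-1 * \sum_(q < l) `|alpha q| * (m q)%:R * ((m q).-1)%:R).

Definition approx_fixed_points {R : realType} {l : nat} (n : nat)
    (m : 'I_l -> nat) (alpha : 'I_l -> R) (p : R) : set (vec R n) :=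
  [set x | unit_cube R n x /\
    l1norm (fun i => tnth x i - (1 + tanh (grad n m alpha p x i)) / 2)
      <= 5000 * C_alpha m alpha p ^+ 2 * n%:R `^ (7 / 8)].

Arguments approx_fixed_points {R l} n m alpha p.

(* approx_fixed_points is measurable, so that rho (approx_fixed_points ...) is a
   genuine probability for every probability measure rho. *)
Lemma measurable_prod_tnth (R : realType) (n : nat) (s : seq 'I_n) :
  measurable_fun [set: vec R n]
    (fun x : vec R n => \prod_(i <- s) (tnth x i : R)).
Proof.
apply: (@measurable_prod _ _ R setT _ s (fun i x => tnth x i)).
move=> i _; exact: measurable_tnth.
Qed.

Lemma measurable_grad (R : realType) (n l : nat) (m : 'I_l -> nat)
    (alpha : 'I_l -> R) (p : R) (j : 'I_n) :
  measurable_fun [set: vec R n] (fun x => grad n m alpha p x j).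
Proof.
apply: measurable_funD; first exact: measurable_cst.
apply: measurable_sum => q.
apply: measurable_funM; first exact: measurable_cst.
pose h (t : (m q).-1.-tuple 'I_n) (x : vec R n) : R :=
  if uniq (j :: t) then \prod_(i <- t) tnth x i else 0.
rewrite (_ : punctured_sum _ _ = fun x => \sum_t h t x); last first.
  by apply/funext => x; exact: big_mkcond.
apply: measurable_sum => t; rewrite /h; case: (uniq _); last exact: measurable_cst.
exact: measurable_prod_tnth.
Qed.

Lemma measurable_unit_cube (R : realType) (n : nat) : measurable (unit_cube R n).
Proof.
rewrite (_ : unit_cube R n = \bigcap_(i in [set: 'I_n])
    ([set: vec R n] `&` (fun x => tnth x i) @^-1` [set` `[0 : R, 1]])); last first.
  apply/seteqP; split=> [x xP i _|x xP i].
    by split=> //=; rewrite in_itv/=; exact: xP.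
  by have [_ /=] := xP i I; rewrite in_itv.
apply: fin_bigcap_measurable => // i _; exact: measurable_tnth.
Qed.

Lemma measurable_approx_fixed_points (R : realType) (n l : nat)
    (m : 'I_l -> nat) (alpha : 'I_l -> R) (p : R) :
  measurable (approx_fixed_points n m alpha p).
Proof.
apply: measurable_fun_le; first exact: measurable_unit_cube.
  apply: measurable_funTS; apply: measurable_sum => i.
  apply: measurableT_comp; first exact: normr_measurable.
  apply: measurable_funB; first exact: measurable_tnth.
  apply: measurable_funM => //; apply: measurable_funD => //.
  have tanh_cont : continuous (@tanh R).
    move=> t; apply: cvgM.
      by apply: cvgB; [exact: continuous_expR|
        apply: continuous_comp; [exact: opp_continuous|exact: continuous_expR]].
    apply: cvgV; first by rewrite gt_eqF// addr_gt0 ?expR_gt0.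
    by apply: cvgD; [exact: continuous_expR|
      apply: continuous_comp; [exact: opp_continuous|exact: continuous_expR]].
  apply: measurableT_comp; first exact: continuous_measurable_fun.
  exact: measurable_grad.
exact: measurable_cst.
Qed.

(* The law of a random configuration is represented by its probability mass
   function config n -> R, and a coupling by a joint mass function. *)

Definition gibbs {R : realType} {n : nat} (f : config n -> R) (X : config n) : R :=
  expR (f X) / \sum_(Y : config n) expR (f Y).

Definition bernoulli_law {R : realType} {n : nat} (x : vec R n) (X : config n) : R :=
  \prod_(i < n) (if tnth X i then tnth x i else 1 - tnth x i).

(* Meant for rho giving mass 1 to unit_cube R n: this is then the law of
   G(n, rho). *)
Definition mixture_law {R : realType} {n : nat}
    (rho : probability (vec R n) R) (X : config n) : R :=
  \int[rho]_(x in unit_cube R n) bernoulli_law x X.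

Definition is_coupling {R : realType} {n : nat} (mu nu : config n -> R)
    (pi : config n * config n -> R) : Prop :=
  [/\ forall c, 0 <= pi c,
      forall X, \sum_(Y : config n) pi (X, Y) = mu X
    & forall Y, \sum_(X : config n) pi (X, Y) = nu Y].

Definition is_mixture {R : realType} {n : nat} (rho : probability (vec R n) R)
    (delta : R) (mu : config n -> R) : Prop :=
  exists pi : config n * config n -> R,
    is_coupling (mixture_law rho) mu pi /\
    \sum_(c : config n * config n)
      pi c * l1norm (fun i => tnth (weight c.1) i - tnth (weight c.2) i)
    <= delta * n%:R.

(* Main.v *)
From HB Require Import structures.
Require Import Defs.
From mathcomp Require Import all_boot all_order all_algebra.
From mathcomp Require Import all_classical all_reals all_analysis.
From mathcomp Require Import fingroup perm measurable_realfun ring lra zify.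

Set Implicit Arguments.
Unset Strict Implicit.
Unset Printing Implicit Defensive.
Import Order.TTheory GRing.Theory Num.Theory.
Local Open Scope ring_scope.

(** Permuting the coordinates of a configuration [X] does not change [f X],
so [f] depends on [X] only through the number [N] of its ones, and under the
Gibbs law [X] is uniform on the configurations with [N] ones given [N].  This
suggests the mixing measure: [rho] is the law of the constant vector [N / n],
with [N] distributed as under the Gibbs law.

Why the mixture is close to the Gibbs law.  Given [N], both laws to be coupled
are invariant under permutations, so it is enough to couple the numbers of
ones ([exchangeable_coupling]): applying one random permutation to two initial
segments moves them with no further loss.  The number of ones of a product of
[n] Bernoulli variables of parameter [N / n] is at mean distance at most
[sqrt n] from [N] ([bernoulli_mean_deviation]).

Why [N / n] is nearly a fixed point.  Under the Gibbs law the conditional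
probability that [X_i = 1], given the other coordinates, is exactly
[u_i = (1 + tanh (d_i f X)) / 2].  The sum [S] of the [X_i - u_i] therefore
has small second moment: in [E (X_i - u_i) S] only the dependence of [S] on
[X_i] survives, and flipping a coordinate changes [S] by [O(C_alpha)], so that
[E S^2 = O(C_alpha n)] ([second_moment_drift], applied in
[gibbs_drift_second_moment]; the same lemma with a constant [u] gives the
Bernoulli bound above).  Replacing [X] by the constant vector [N / n] in the
gradient turns a falling factorial into a power and costs
[O(C_alpha / sqrt n)] per coordinate ([grad_weight_const_dist]); hence the
1-norm which measures the failure of the fixed-point equation is at most
[|S| + O(C_alpha sqrt n)] ([density_fixed_point_error]).  Chebyshev's
inequality at level [|S| = C_alpha n^(7/8)] concludes. *)

(** * Resampling one coordinate *)

Lemma tnth_set_coord (n : nat) (X : config n) (i k : 'I_n) (b : bool) :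
  tnth (set_coord X i b) k = if k == i then b else tnth X k.
Proof. by rewrite tnth_mktuple. Qed.

Lemma set_coordK (n : nat) (X : config n) (i : 'I_n) (a b : bool) :
  set_coord (set_coord X i a) i b = set_coord X i b.
Proof. by apply: eq_from_tnth => k; rewrite !tnth_set_coord; case: eqP. Qed.

Lemma set_coord_id (n : nat) (X : config n) (i : 'I_n) :
  set_coord X i (tnth X i) = X.
Proof. by apply: eq_from_tnth => k; rewrite tnth_set_coord; case: eqP => // ->. Qed.

(** Flipping coordinate [i] is an involution, so summing over both values of
that coordinate counts every configuration twice. *)
Lemma sum_set_coord (R : realType) (n : nat) (G : config n -> R) (i : 'I_n) :
  \sum_X (G (set_coord X i true) + G (set_coord X i false)) = 2 * \sum_X G X.
Proof.
pose flip (X : config n) := set_coord X i (~~ tnth X i).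
have flipK : cancel flip flip.
  move=> X; rewrite /flip set_coordK tnth_set_coord eqxx negbK.
  exact: set_coord_id.
rewrite mulr_natl mulr2n [X in _ = _ + X](reindex_inj (can_inj flipK)) -big_split/=.
apply: eq_bigr => X _; rewrite /flip.
have := set_coord_id X i.
by case: (tnth X i) => ->; rewrite // addrC.
Qed.

(** When [u X i] is the conditional probability that coordinate [i] is 1, the
terms of this sum are centred given the other coordinates. *)
Definition drift {R : realType} {n : nat} (u : config n -> 'I_n -> R)
    (X : config n) : R :=
  \sum_(i < n) ((tnth X i)%:R - u X i).

(** The last two hypotheses before the Lipschitz bound say that [u X i] is the
conditional probability under [mu] that [X_i = 1], given the other
coordinates.  Then [E (X_i - u_i) g = 0] for every [g] that ignores
coordinate [i], so [E (X_i - u_i) S = E (X_i - u_i) (S - S')] where [S'] is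
the drift [S] with coordinate [i] set to 0, and this is at most [L].
Summing over [i] bounds [E S^2]. *)
Lemma second_moment_drift (R : realType) (n : nat) (mu : config n -> R)
    (u : config n -> 'I_n -> R) (L : R) :
  (forall X, 0 <= mu X) -> \sum_X mu X = 1 ->
  (forall X i, 0 <= u X i <= 1) ->
  (forall X i b, u (set_coord X i b) i = u X i) ->
  (forall X i, mu (set_coord X i true) * (1 - u X i) =
               mu (set_coord X i false) * u X i) ->
  (forall X i, `|drift u (set_coord X i true)
                 - drift u (set_coord X i false)| <= L) ->
  \sum_X mu X * drift u X ^+ 2 <= L * n%:R.
Proof.
move=> mu0 mu1 u01 u_loc balance lip.
have site i : \sum_X mu X * ((tnth X i)%:R - u X i) * drift u X <= L.
  (* Group the configurations in pairs that differ at [i]; by the balance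
  hypothesis a pair contributes [a (1 - v) (D1 - D0)]. *)
  rewrite -(ler_pM2l (ltr0Sn R 1)) -(sum_set_coord _ i).
  rewrite [leRHS](_ : _ = \sum_X L * (mu (set_coord X i true)
      + mu (set_coord X i false))); last first.
    by rewrite -mulr_sumr sum_set_coord mu1; ring.
  apply: ler_sum => X _; rewrite !u_loc !tnth_set_coord eqxx sub0r.
  have := u01 X i; have := balance X i; have := lip X i.
  set X1 := set_coord X i true; set X0 := set_coord X i false.
  move: (drift u X1) (drift u X0) => D1 D0.
  have := mu0 X1; have := mu0 X0.
  move: (mu X1) (mu X0) (u X i) => a b v b0 a0 D_le av /andP[v0 v1].
  rewrite -[true%:R]/(1 : R).
  have -> : a * (1 - v) * D1 + b * - v * D0 = a * (1 - v) * (D1 - D0).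
    by rewrite mulrN mulNr -av; ring.
  have L0 : 0 <= L by exact: le_trans D_le.
  apply: (@le_trans _ _ (a * (1 - v) * L)).
    by rewrite ler_wpM2l ?mulr_ge0 ?subr_ge0// (le_trans (ler_norm _)).
  rewrite mulrC ler_wpM2l// (@le_trans _ _ a)//; first by rewrite ler_piMr//; lra.
  by rewrite lerDl.
apply: (@le_trans _ _ (\sum_(i < n) L)); last first.
  by rewrite sumr_const card_ord mulr_natr.
apply: le_trans (ler_sum _ (fun i _ => site i)).
rewrite exchange_big/=; apply: ler_sum => X _.
by rewrite -mulr_suml -mulr_sumr expr2 mulrA.
Qed.

(** * Gradients as falling factorials *)

Definition ones {n : nat} (X : config n) : nat := #|[pred i | tnth X i]|.

Lemma ones_sum (R : realType) (n : nat) (X : config n) :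
  (ones X)%:R = \sum_(i < n) (tnth X i)%:R :> R.
Proof.
rewrite /ones -sum1_card natr_sum [LHS]big_mkcond/=.
by apply: eq_bigr => i _; rewrite inE; case: (tnth X i).
Qed.

Lemma ones_le (n : nat) (X : config n) : (ones X <= n)%N.
Proof. by rewrite -[leqRHS]card_ord max_card. Qed.

(** Repetition-free tuples on which all factors are nonzero are counted by a
falling factorial; [A] encodes the constraint that the tuple avoids a given
index, [P] the support of the vector, and [c] its constant value there. *)
Lemma sum_uniq_indicator (R : realType) (n r : nat) (A : pred 'I_n)
    (P : pred 'I_n) (c : R) :
  \sum_(t : r.-tuple 'I_n | uniq t && all A t) \prod_(i <- t) (c * (P i)%:R)
  = c ^+ r * (#|[predI A & P]| ^_ r)%:R.
Proof.
rewrite -card_uniq_tuples -sum1_card natr_sum mulr_sumr.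
rewrite big_mkcond [RHS]big_mkcond/=; apply: eq_bigr => t _.
rewrite !inE /= all_predI; case: (uniq t) => //=; last by rewrite andbF.
rewrite andbT; case: (all A t) => //=; rewrite big_split/=.
rewrite big_const_seq count_predT size_tuple iter_mulr_1.
case: (boolP (all P t)) => tP; last first.
  have [i it /negPf Pi] := allPn tP.
  by rewrite (_ : \prod_(_ <- _) _ = 0) ?mulr0//; apply/eqP;
    rewrite prodf_seq_eq0; apply/hasP; exists i => //=; rewrite Pi.
rewrite big_seq big1 ?mulr1// => i /(allP tP) ->; exact: erefl.
Qed.

Lemma uniq_consE (T : eqType) (j : T) (t : seq T) :
  uniq (j :: t) = uniq t && all (predC1 j) t.
Proof.
rewrite /= andbC; congr (_ && _); apply/idP/allP => [jt i it|tj].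
  by apply/eqP => ij; rewrite -ij it in jt.
by apply/negP => /tj; rewrite /= eqxx.
Qed.

Lemma distinct_sum_weight (R : realType) (n r : nat) (X : config n) :
  distinct_sum r (weight X : vec R n) = (ones X ^_ r)%:R.
Proof.
transitivity (1 ^+ r * (#|[predI predT & [pred i | tnth X i]]| ^_ r)%:R : R).
  rewrite -sum_uniq_indicator; apply: eq_big => [t|t _]; first by rewrite all_predT andbT.
  by apply: eq_bigr => i _; rewrite tnth_mktuple mul1r.
by rewrite expr1n mul1r.
Qed.

Lemma punctured_sum_weight (R : realType) (n r : nat) (j : 'I_n) (X : config n) :
  punctured_sum r j (weight X : vec R n)
  = (ones (set_coord X j false) ^_ r.-1)%:R.
Proof.
transitivity (1 ^+ r.-1 * (#|[predI predC1 j & [pred i | tnth X i]]| ^_ r.-1)%:R : R).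
  rewrite -sum_uniq_indicator; apply: eq_big => [t|t _]; first exact: uniq_consE.
  by apply: eq_bigr => i _; rewrite tnth_mktuple mul1r.
rewrite expr1n mul1r /ones; congr (_ ^_ _)%:R; apply: eq_card => i.
by rewrite !inE tnth_set_coord; case: eqP.
Qed.

Lemma punctured_sum_const (R : realType) (n r : nat) (j : 'I_n) (c : R) :
  punctured_sum r j ([tuple c | i < n] : vec R n) = c ^+ r.-1 * (n.-1 ^_ r.-1)%:R.
Proof.
transitivity (c ^+ r.-1 * (#|[predI predC1 j & predT]| ^_ r.-1)%:R : R).
  rewrite -sum_uniq_indicator; apply: eq_big => [t|t _]; first exact: uniq_consE.
  by apply: eq_bigr => i _; rewrite tnth_mktuple mulr1.
rewrite -[in RHS](card_ord n) -(cardC1 j); congr (_ * (_ ^_ _)%:R).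
by apply: eq_card => i; rewrite !inE andbT.
Qed.

Lemma ones_set_coord (n : nat) (X : config n) (j : 'I_n) :
  ones (set_coord X j true) = (ones (set_coord X j false)).+1.
Proof.
rewrite /ones (cardD1 j) inE tnth_set_coord eqxx; congr _.+1.
by apply: eq_card => i; rewrite !inE !tnth_set_coord; case: eqP.
Qed.

(** * Conditional probabilities of the Gibbs law *)

Lemma half_tanhE (R : realType) (t : R) :
  (1 + tanh t) / 2 = expR t / (expR t + expR (- t)).
Proof.
rewrite /tanh; field.
by rewrite gt_eqF// addr_gt0 ?expR_gt0.
Qed.

Lemma half_tanh_ge0_le1 (R : realType) (t : R) : 0 <= (1 + tanh t) / 2 <= 1.
Proof.
have := expR_gt0 t; have := expR_gt0 (- t) => b0 a0; rewrite half_tanhE.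
apply/andP; split; first by rewrite divr_ge0 ?ltW// addr_gt0.
by rewrite ler_pdivrMr ?addr_gt0// mul1r lerDl ltW.
Qed.

(** In terms of [x = exp (- 2a) <= y = exp (- 2b)] the difference is
[1 / (1 + x) - 1 / (1 + y) <= (y - x) / y = 1 - exp (- 2 (a - b))], and
[exp t >= 1 + t].  The constant 2 is not optimal, but this argument needs no
derivative. *)
Lemma half_tanh_lipschitz (R : realType) (a b : R) :
  `|(1 + tanh a) / 2 - (1 + tanh b) / 2| <= 2 * `|a - b|.
Proof.
have sigmoid (t : R) : (1 + tanh t) / 2 = (1 + expR (- (2 * t)))^-1.
  rewrite half_tanhE (_ : - (2 * t) = - t - t); last by ring.
  rewrite expRD expRN; have := expR_gt0 t; move: (expR t) => y y0.
  by field; rewrite !gt_eqF ?addr_gt0 ?mulr_gt0.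
wlog ab : a b / b <= a.
  move=> wl; case: (leP b a) => [|/ltW ab]; first exact: wl.
  by rewrite distrC (distrC a) wl.
rewrite (ger0_norm (_ : 0 <= a - b)) ?subr_ge0// !sigmoid.
have x0 := expR_gt0 (- (2 * a)); have y0 := expR_gt0 (- (2 * b)).
have x_le : expR (- (2 * a)) <= expR (- (2 * b)) by rewrite ler_expR; lra.
have : 1 + - (2 * (a - b)) <= expR (- (2 * a)) / expR (- (2 * b)).
  apply: le_trans (expR_ge1Dx _) _.
  by rewrite -expRN -expRD ler_expR; lra.
move: (expR (- (2 * a))) (expR (- (2 * b))) x0 y0 x_le => x y x0 y0 x_le ratio.
rewrite ger0_norm; last by rewrite subr_ge0 lef_pV2 ?posrE ?lerD2l// addr_gt0.
apply: (@le_trans _ _ (1 - x / y)); last by lra.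
rewrite (_ : _ - _ = (y - x) / ((1 + x) * (1 + y))); last first.
  by field; rewrite !gt_eqF//; lra.
rewrite (_ : 1 - _ = (y - x) / y); last by field; rewrite gt_eqF.
rewrite ler_wpM2l ?subr_ge0// lef_pV2 ?posrE//; first by nra.
by rewrite mulr_gt0//; lra.
Qed.

(** The odds of [X_i = 1] against [X_i = 0] are
[exp (f X1 - f X0) = exp (2 d)], with [d] the discrete derivative; hence the
conditional probability of a one is [exp d / (exp d + exp (- d))]. *)
Lemma gibbs_balance (R : realType) (n : nat) (f : config n -> R) (X : config n)
    (i : 'I_n) :
  gibbs f (set_coord X i true) * (1 - (1 + tanh (discrete_grad f X i)) / 2)
  = gibbs f (set_coord X i false) * ((1 + tanh (discrete_grad f X i)) / 2).
Proof.
rewrite half_tanhE /gibbs /discrete_grad.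
set d := 2^-1 * _; set Z := \sum_Y _.
have D0 : expR d + expR (- d) != 0 by rewrite gt_eqF// addr_gt0 ?expR_gt0.
rewrite (_ : 1 - _ = expR (- d) / (expR d + expR (- d))); last by field.
rewrite !mulrA; congr (_ / _); rewrite -!mulrA ![Z^-1 * _]mulrC !mulrA.
by rewrite -!expRD; congr (expR _ / _); rewrite /d; field.
Qed.

Lemma sum_expR_gt0 (R : realType) (n : nat) (f : config n -> R) :
  0 < \sum_(Y : config n) expR (f Y).
Proof.
rewrite (bigD1 [tuple false | i < n])//= ltr_wpDr ?expR_gt0//.
by apply: sumr_ge0 => Y _; exact: expR_ge0.
Qed.

Lemma gibbs_ge0 (R : realType) (n : nat) (f : config n -> R) (X : config n) :
  0 <= gibbs f X.
Proof. by rewrite divr_ge0 ?expR_ge0// ltW// sum_expR_gt0. Qed.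

Lemma sum_gibbs (R : realType) (n : nat) (f : config n -> R) :
  \sum_X gibbs f X = 1.
Proof. by rewrite -mulr_suml divff// gt_eqF// sum_expR_gt0. Qed.

(** * Sensitivity of the gradient *)

Lemma ffact_succ (k r : nat) : (k.+1 ^_ r.+1 = k ^_ r.+1 + r.+1 * k ^_ r)%N.
Proof.
rewrite ffactSS ffactnSr; case: (leqP r k) => [rk|kr].
  by rewrite [(r.+1 * _)%N]mulnC -mulnDr mulnC; congr (_ * _)%N; lia.
by rewrite ffact_small// !muln0.
Qed.

Lemma ffact_le_expn (k n r : nat) : (k <= n)%N -> (k ^_ r <= n ^ r)%N.
Proof.
move=> kn; elim: r => // r IHr; rewrite ffactnSr expnSr leq_mul//.
exact: leq_trans (leq_subr _ _) kn.
Qed.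

Lemma dist_mul_le (R : realDomainType) (a b c d : R) :
  0 <= b <= 1 -> 0 <= c <= 1 -> `|a * c - b * d| <= `|a - b| + `|c - d|.
Proof.
move=> /andP[b0 b1] /andP[c0 c1].
rewrite (_ : _ - _ = (a - b) * c + b * (c - d)); last by ring.
apply: le_trans (ler_normD _ _) _; rewrite !normrM (ger0_norm b0) (ger0_norm c0).
by rewrite lerD// ?ler_piMr// ler_piMl.
Qed.

(** Comparison of [k ^_ r], which is [punctured_sum] at a configuration, with
[(N / n)^r * (n - 1) ^_ r], which is [punctured_sum] at the constant vector
[N / n]; here [k] is [N] or [N - 1] according to the deleted coordinate.  Both
are products of [r] factors, and after division by [n] the factors of rank
[i] differ by at most [(i + 1) / n]. *)
Section falling_factorial_vs_power.
Variables (R : realType) (n k N : nat).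
Hypotheses (n_gt0 : (0 < n)%N) (k_lt : (k < n)%N).
Hypothesis k_N : (k <= N <= k.+1)%N.

Let nR_gt0 : 0 < n%:R :> R. Proof. by rewrite ltr0n. Qed.

Let n_neq0 : n%:R != 0 :> R. Proof. by rewrite gt_eqF. Qed.

Let a (i : nat) : R := (k - i)%:R / n%:R.
Let b (i : nat) : R := N%:R / n%:R * ((n.-1 - i)%:R / n%:R).

Let ratio_ge0_le1 (c : nat) : (c <= n)%N -> 0 <= (c%:R / n%:R : R) <= 1.
Proof.
by move=> cn; rewrite divr_ge0 ?ler0n//= ler_pdivrMr// mul1r ler_nat.
Qed.

Let factor_dist (i : nat) : `|a i - b i| <= (i.+1)%:R / n%:R.
Proof.
have [i_le|k_lti] := leqP i k; last first.
  have ki0 : (k - i = 0)%N by lia.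
  rewrite /a ki0 mul0r sub0r normrN ger0_norm; last by rewrite !mulr_ge0 ?invr_ge0.
  have : 0 <= ((n.-1 - i)%:R / n%:R : R) <= 1 by apply: ratio_ge0_le1; lia.
  case/andP=> _ le1; apply: (@le_trans _ _ (N%:R / n%:R)).
    by rewrite ler_piMr// divr_ge0.
  by rewrite ler_wpM2r ?invr_ge0// ler_nat; lia.
(* With [N = k] or [N = k + 1], the numerator below lies between
[- (i + 1) n] and [(i + 1) n]. *)
have -> : a i - b i = ((k%:R - i%:R) * n%:R - N%:R * (n%:R - 1 - i%:R)) / n%:R ^+ 2.
  rewrite /a /b !natrB//; last by lia.
  rewrite (_ : n.-1%:R = n%:R - 1 :> R); first by field; rewrite gt_eqF.
  by rewrite -(prednK n_gt0) -natr1 addrK.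
have k_le : k%:R + 1 <= n%:R :> R by rewrite natr1 ler_nat.
have i0 : 0 <= i%:R :> R by [].
have ik : i%:R <= k%:R :> R by rewrite ler_nat.
rewrite normrM normfV (ger0_norm (exprn_ge0 2 (ltW nR_gt0))).
rewrite [leRHS](_ : _ = (i.+1)%:R * n%:R / n%:R ^+ 2); last first.
  by field; rewrite gt_eqF.
rewrite ler_wpM2r ?invr_ge0 ?exprn_ge0// -natr1.
have n0 := nR_gt0.
have /orP[/eqP->|/eqP->] : (N == k) || (N == k.+1) by lia.
  by rewrite ler_norml; apply/andP; split; nra.
by rewrite -natr1 ler_norml; apply/andP; split; nra.
Qed.

Let A (r : nat) : R := (k ^_ r)%:R / n%:R ^+ r.
Let B (r : nat) : R := (N%:R / n%:R) ^+ r * ((n.-1 ^_ r)%:R / n%:R ^+ r).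

Let A_ge0_le1 (r : nat) : 0 <= A r <= 1.
Proof.
rewrite /A divr_ge0//= ler_pdivrMr ?exprn_gt0// mul1r -natrX ler_nat.
by rewrite ffact_le_expn// ltnW.
Qed.

Let B_ge0_le1 (r : nat) : 0 <= B r <= 1.
Proof.
have /andP[q0 q1] : 0 <= (N%:R / n%:R : R) <= 1 by apply: ratio_ge0_le1; lia.
rewrite /B mulr_ge0 ?exprn_ge0 ?divr_ge0//=.
rewrite mulr_ile1 ?exprn_ge0 ?divr_ge0 ?exprn_ile1//.
by rewrite ler_pdivrMr ?exprn_gt0// mul1r -natrX ler_nat ffact_le_expn// leq_pred.
Qed.

Let dist_sqr (r : nat) : `|A r - B r| <= r%:R ^+ 2 / n%:R.
Proof.
elim: r => [|r IHr]; first by rewrite /A /B !expr0 !ffactn0 !mul1r subrr normr0 expr0n/= mul0r.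
have -> : A r.+1 = A r * a r.
  by rewrite /A /a ffactnSr exprSr natrM; field; rewrite expf_neq0 n_neq0.
have -> : B r.+1 = B r * b r.
  by rewrite /B /b ffactnSr !exprSr natrM; field; rewrite expf_neq0 n_neq0.
apply: le_trans (dist_mul_le _ _ _ _) _ => //.
  by rewrite /a; apply: ratio_ge0_le1; lia.
apply: le_trans (lerD IHr (factor_dist r)) _.
rewrite -mulrDl ler_wpM2r ?invr_ge0// -natr1.
have : 0 <= r%:R :> R by [].
by move=> r0; nra.
Qed.

(** Accumulating the factors gives [r^2 / n], which is of too high degree in
[r] for [C_alpha]; but both normalized quantities also lie in [0, 1], and
[min 1 (r^2 / n) <= r / sqrt n]. *)
Lemma ffact_power_dist (r : nat) :
  `|(k ^_ r)%:R - (N%:R / n%:R) ^+ r * (n.-1 ^_ r)%:R|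
    <= r%:R * (Num.sqrt n%:R)^-1 * n%:R ^+ r :> R.
Proof.
have -> : (k ^_ r)%:R - (N%:R / n%:R) ^+ r * (n.-1 ^_ r)%:R
    = (A r - B r) * n%:R ^+ r.
  by rewrite /A /B; field; rewrite expf_neq0.
rewrite normrM (ger0_norm (exprn_ge0 _ (ltW nR_gt0))) ler_wpM2r ?exprn_ge0//.
set s := Num.sqrt n%:R.
have s0 : 0 < s by rewrite sqrtr_gt0.
have nE : n%:R = s ^+ 2 by rewrite sqr_sqrtr.
rewrite ler_pdivlMr//; have [r_le|/ltW r_ge] := leP r%:R s.
  apply: (@le_trans _ _ (r%:R ^+ 2 / n%:R * s)).
    by rewrite ler_wpM2r// ltW.
  rewrite nE (_ : _ * s = r%:R * (r%:R / s)); last by field; rewrite gt_eqF.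
  by rewrite ler_piMr// ler_pdivrMr// mul1r.
apply: le_trans r_ge; rewrite ler_piMl ?(ltW s0)//.
have /andP[? ?] := A_ge0_le1 r; have /andP[? ?] := B_ge0_le1 r.
by rewrite ler_norml; apply/andP; split; lra.
Qed.

End falling_factorial_vs_power.

Lemma C_alpha_ge2 (R : realType) (l : nat) (m : 'I_l -> nat) (alpha : 'I_l -> R)
    (p : R) : 2 <= C_alpha m alpha p.
Proof. by rewrite /C_alpha le_max lexx. Qed.

(** The factor [(m q).-1] in the hypothesis is the one that turns the
coefficients of the gradient into those of [C_alpha]. *)
Lemma grad_dist (R : realType) (l n : nat) (m : 'I_l -> nat) (alpha : 'I_l -> R)
    (p : R) (x y : vec R n) (j : 'I_n) (e : R) :
  0 <= e ->
  (forall q, `|punctured_sum (m q) j x - punctured_sum (m q) j y|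
               <= (m q).-1%:R * e * n%:R ^+ (m q).-1) ->
  `|grad n m alpha p x j - grad n m alpha p y j| <= C_alpha m alpha p * e.
Proof.
move=> e0 dist.
have n0 : 0 < n%:R :> R by rewrite ltr0n (leq_ltn_trans _ (ltn_ord j)).
rewrite /grad opprD addrACA subrr add0r.
apply: (@le_trans _ _ ((2^-1 * \sum_(q < l) `|alpha q| * (m q)%:R * ((m q).-1)%:R) * e)).
  rewrite -sumrB mulr_sumr mulr_suml; apply: le_trans (ler_norm_sum _ _ _) _.
  apply: ler_sum => q _; rewrite -mulrBr !normrM normfV normrM normrX !normr_nat.
  have := ler_wpM2l (_ : 0 <= (m q)%:R * `|alpha q| / (2 * n%:R ^+ (m q).-1)) (dist q).
  move=> /(_ _)/le_trans; apply; first by rewrite !mulr_ge0// invr_ge0 mulr_ge0// exprn_ge0.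
  rewrite le_eqVlt; apply/orP; left; apply/eqP.
  by field; rewrite expf_neq0// gt_eqF.
by rewrite ler_wpM2r// /C_alpha le_max lerDr mulr_ge0 ?orbT.
Qed.

Lemma set_coordC (n : nat) (X : config n) (i j : 'I_n) (a b : bool) :
  j != i -> set_coord (set_coord X i a) j b = set_coord (set_coord X j b) i a.
Proof.
move=> /negPf ji; apply: eq_from_tnth => k; rewrite !tnth_set_coord.
by case: (eqVneq k j) => // ->; rewrite ji.
Qed.

(** Flipping [X_i] changes the falling factorial [k ^_ (m - 1)] into
[k.+1 ^_ (m - 1)], a difference of [(m - 1) * k ^_ (m - 2)]. *)
Lemma grad_weight_lipschitz (R : realType) (l n : nat) (m : 'I_l -> nat)
    (alpha : 'I_l -> R) (p : R) (X : config n) (i j : 'I_n) :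
  (forall q, (2 <= m q)%N) -> j != i ->
  `|grad n m alpha p (weight (set_coord X i true)) j
    - grad n m alpha p (weight (set_coord X i false)) j|
    <= C_alpha m alpha p * n%:R^-1.
Proof.
move=> m_ge2 ji.
have n0 : 0 < n%:R :> R by rewrite ltr0n (leq_ltn_trans _ (ltn_ord j)).
apply: grad_dist => [|q]; first by rewrite invr_ge0.
rewrite !punctured_sum_weight ![set_coord (set_coord X i _) _ _]set_coordC//.
rewrite ones_set_coord; set k := ones _.
have := m_ge2 q; case: (m q) => [|[|r]]//= _.
rewrite ffact_succ natrD addrAC subrr add0r normr_nat natrM.
rewrite exprS -!mulrA ler_wpM2l// mulKf ?gt_eqF// -natrX ler_nat.
by rewrite ffact_le_expn// ones_le.
Qed.

Lemma grad_weight_const_dist (R : realType) (l n : nat) (m : 'I_l -> nat)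
    (alpha : 'I_l -> R) (p : R) (X : config n) (j : 'I_n) :
  `|grad n m alpha p (weight X) j
    - grad n m alpha p [tuple (ones X)%:R / n%:R | i < n] j|
    <= C_alpha m alpha p * (Num.sqrt n%:R)^-1.
Proof.
have n0 : (0 < n)%N by exact: leq_ltn_trans (ltn_ord j).
apply: grad_dist => [|q]; first by rewrite invr_ge0 sqrtr_ge0.
rewrite punctured_sum_weight punctured_sum_const.
have := ones_set_coord X j; have := set_coord_id X j.
case: (tnth X j) => XE oE; apply: ffact_power_dist => //.
- by rewrite -oE XE ones_le.
- by rewrite -XE oE set_coordK leqnSn leqnn.
- by rewrite -oE ones_le.
- by rewrite XE leqnSn leqnn.
Qed.

(** * Coupling exchangeable laws *)

Definition permute {n : nat} (s : {perm 'I_n}) (X : config n) : config n :=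
  [tuple tnth X (s i) | i < n].

Definition initial_ones (n k : nat) : config n := [tuple (i < k)%N | i < n].

Lemma permuteV (n : nat) (s : {perm 'I_n}) (X Y : config n) :
  (X == permute s Y) = (Y == permute (s^-1)%g X).
Proof.
apply/eqP/eqP => ->; apply: eq_from_tnth => i;
  by rewrite !tnth_mktuple ?permK ?permKV.
Qed.

Lemma permuteM (n : nat) (s t : {perm 'I_n}) (X : config n) :
  permute s (permute t X) = permute (s * t)%g X.
Proof. by apply: eq_from_tnth => i; rewrite !tnth_mktuple permM. Qed.

Lemma ones_permute (n : nat) (s : {perm 'I_n}) (X : config n) :
  ones (permute s X) = ones X.
Proof.
rewrite /ones -!sum1_card [RHS](reindex_inj (@perm_inj _ s)).
by apply: eq_bigl => i; rewrite !inE tnth_mktuple.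
Qed.

Lemma ones_initial (n k : nat) : (k <= n)%N -> ones (initial_ones n k) = k.
Proof.
move=> kn; rewrite /ones -sum1_card.
under eq_bigl do rewrite inE tnth_mktuple.
by rewrite (big_ord_narrow kn) sum1_card card_ord.
Qed.

Lemma ones_eq_permute (n : nat) (X Y : config n) :
  ones X = ones Y -> exists s, X = permute s Y.
Proof.
have onesE (Z : config n) : ones Z = count_mem true Z.
  rewrite /ones -sum1_card -sum1_count big_tuple.
  by apply: eq_bigl => i; rewrite !inE; case: (tnth Z i).
have zerosE (Z : config n) : count_mem false Z = (n - ones Z)%N.
  rewrite onesE -[X in (X - _)%N](size_tuple Z) -(count_predC (pred1 true) Z) addKn.
  by apply: eq_count => -[].
move=> XY; have : perm_eq X Y.
  by apply/allP => -[] _; rewrite /= -?onesE ?zerosE XY eqxx.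
by case/tuple_permP => s Xs; exists s; exact: val_inj.
Qed.

Lemma sum_eq_mul (R : realType) (I : finType) (a : I) (g : I -> R) :
  \sum_b (b == a)%:R * g b = g a.
Proof.
rewrite (bigD1 a)//= eqxx mul1r big1 ?addr0// => b /negPf ->.
by rewrite mul0r.
Qed.

(** A permutation-invariant law is recovered by sampling its number of ones and
applying a uniform permutation to an initial segment of that length: the
segment is itself a permutation of the sampled configuration [W], so up to
reindexing the permutation is applied to [W], and invariance concludes. *)
Lemma symmetric_orbit_average (R : realType) (n : nat) (phi : config n -> R)
    (Y : config n) :
  (forall s X, phi (permute s X) = phi X) ->
  \sum_W phi W * (#|{perm 'I_n}|%:R^-1
     * \sum_s (Y == permute s (initial_ones n (ones W)))%:R) = phi Y.
Proof.
move=> phi_sym.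
have orbit W : \sum_s (Y == permute s (initial_ones n (ones W)))%:R
    = \sum_s (W == permute s Y)%:R :> R.
  have [t ->] : exists t, initial_ones n (ones W) = permute t W.
    by apply: ones_eq_permute; rewrite ones_initial ?ones_le.
  rewrite [RHS](reindex_inj invg_inj) [RHS](reindex_inj (mulIg t)).
  by apply: eq_bigr => s _; rewrite permuteM permuteV.
under eq_bigr do rewrite orbit mulrCA mulr_sumr.
rewrite -mulr_sumr exchange_big/=.
under eq_bigr => s _.
  under eq_bigr do rewrite mulrC.
  rewrite sum_eq_mul phi_sym; over.
rewrite sumr_const -[phi Y *+ _]mulr_natl mulKf//.
by rewrite pnatr_eq0 -lt0n; apply/card_gt0P; exists 1%g.
Qed.

Lemma l1norm_permute (R : realType) (n : nat) (s : {perm 'I_n}) (X Y : config n) :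
  l1norm (fun i => tnth (weight (permute s X)) i - tnth (weight (permute s Y)) i)
  = l1norm (fun i => tnth (weight X) i - tnth (weight Y) i) :> R.
Proof.
rewrite /l1norm [RHS](reindex_inj (@perm_inj _ s)).
by apply: eq_bigr => i _; rewrite !tnth_mktuple.
Qed.

Lemma l1norm_initial_ones (R : realType) (n j k : nat) :
  (j <= n)%N -> (k <= n)%N ->
  l1norm (fun i => tnth (weight (initial_ones n j)) i
                   - tnth (weight (initial_ones n k)) i)
  = `|j%:R - k%:R| :> R.
Proof.
wlog jk : j k / (j <= k)%N.
  move=> wl jn kn; case/orP: (leq_total j k) => ?; first exact: wl.
  by rewrite distrC -wl//; apply: eq_bigr => i _; rewrite distrC.
move=> jn kn.
rewrite distrC ger0_norm ?subr_ge0 ?ler_nat//.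
rewrite -[in RHS](ones_initial jn) -[in RHS](ones_initial kn) !ones_sum -sumrB.
apply: eq_bigr => i _; rewrite !tnth_mktuple distrC ger0_norm//.
by rewrite subr_ge0 ler_nat; case: (ltnP i j) => // /leq_trans ->.
Qed.

(** Sample [(W, Z)] with weight [J W Z] and apply the same uniform permutation
to the initial segments with as many ones as [W] and as [Z].  By invariance
the two marginals are unchanged, while nested segments are at distance
exactly the difference of their lengths. *)
Lemma exchangeable_coupling (R : realType) (n : nat) (mu nu : config n -> R)
    (J : config n -> config n -> R) :
  (forall W Z, 0 <= J W Z) ->
  (forall W, \sum_Z J W Z = mu W) -> (forall Z, \sum_W J W Z = nu Z) ->
  (forall s X, mu (permute s X) = mu X) -> (forall s X, nu (permute s X) = nu X) ->
  exists pi, is_coupling mu nu pi /\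
    \sum_c pi c * l1norm (fun i => tnth (weight c.1) i - tnth (weight c.2) i)
    = \sum_W \sum_Z J W Z * `|(ones W)%:R - (ones Z)%:R|.
Proof.
move=> J0 Jmu Jnu mu_sym nu_sym.
pose c : R := #|{perm 'I_n}|%:R^-1.
pose P s (W : config n) := permute s (initial_ones n (ones W)).
pose pi (d : config n * config n) : R := \sum_W \sum_Z J W Z *
  (c * \sum_s (d.1 == P s W)%:R * (d.2 == P s Z)%:R).
have c0 : 0 <= c by rewrite invr_ge0.
have sum_c : c * \sum_(s : {perm 'I_n}) 1 = 1.
  rewrite sumr_const mulVf// pnatr_eq0 -lt0n.
  by apply/card_gt0P; exists 1%g.
exists pi; split; first split.
- move=> d; apply: sumr_ge0 => W _; apply: sumr_ge0 => Z _.
  by rewrite !mulr_ge0//; apply: sumr_ge0 => s _; rewrite mulr_ge0.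
- move=> X; rewrite -[RHS](symmetric_orbit_average X mu_sym) /pi exchange_big/=.
  apply: eq_bigr => W _; rewrite -Jmu mulr_suml exchange_big/=.
  apply: eq_bigr => Z _; rewrite -!mulr_sumr exchange_big/=.
  congr (_ * (_ * _)); apply: eq_bigr => s _.
  rewrite -mulr_sumr -[RHS]mulr1; congr (_ * _).
  rewrite -[RHS](sum_eq_mul (P s Z) (fun=> 1)).
  by apply: eq_bigr => Y _; rewrite mulr1.
- move=> Y; rewrite -[RHS](symmetric_orbit_average Y nu_sym) /pi.
  under eq_bigr do rewrite exchange_big/=.
  rewrite exchange_big/=.
  apply: eq_bigr => Z _; rewrite -Jnu mulr_suml exchange_big/=.
  apply: eq_bigr => W _; rewrite -!mulr_sumr exchange_big/=.
  congr (_ * (_ * _)); apply: eq_bigr => s _.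
  by rewrite sum_eq_mul.
under eq_bigr do rewrite mulr_suml.
rewrite exchange_big/=; apply: eq_bigr => W _.
under eq_bigr do rewrite mulr_suml.
rewrite exchange_big/=; apply: eq_bigr => Z _.
under eq_bigr do rewrite -mulrA -mulrA.
rewrite -!mulr_sumr; congr (_ * _).
under eq_bigr do rewrite mulr_suml.
rewrite exchange_big/= -[RHS]mul1r -[X in _ = X * _]sum_c -mulrA mulr_suml; congr (_ * _).
apply: eq_bigr => s _; rewrite mul1r.
rewrite -(l1norm_initial_ones R (ones_le W) (ones_le Z)) -(l1norm_permute _ s).
under eq_bigr do rewrite -mulrA.
rewrite -(pair_bigA _ (fun X Y : config n => (X == P s W)%:R * ((Y == P s Z)%:R
  * l1norm (fun i => tnth (weight X) i - tnth (weight Y) i))))/=.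
under eq_bigr do rewrite -mulr_sumr sum_eq_mul.
by rewrite sum_eq_mul.
Qed.

(** * Finitely supported mixtures *)

Lemma finite_mixture (d : measure_display) (T : measurableType d) (R : realType)
    (I : finType) (w : I -> R) (x : I -> T) :
  (forall i, 0 <= w i) -> \sum_i w i = 1 ->
  exists rho : probability T R,
    (forall A, measurable A -> rho A = (\sum_i w i * (x i \in A)%:R)%:E) /\
    (forall (D : set T) (g : T -> R), measurable D -> measurable_fun D g ->
       (forall y, D y -> 0 <= g y) -> (forall i, D (x i)) ->
       \int[rho]_(y in D) g y = \sum_i w i * g (x i)).
Proof.
move=> w0 w1.
pose atom (i : I) : measure T R := mscale (NngNum (w0 i)) \d_(x i).
(* Finite sums of measures are taken over sequences of measures; the default
[mzero] only makes the sequence total. *)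
pose atoms (k : nat) : measure T R :=
  if (insub k : option 'I_#|I|) is Some o then atom (enum_val o) else mzero.
have atomsE (F : measure T R -> \bar R) :
    (\sum_(k < #|I|) F (atoms k) = \sum_i F (atom i))%E.
  rewrite [RHS](eq_bigl (fun i => i \in [pred i : I | true]))//.
  rewrite [RHS]big_enum_val. apply: eq_bigr => k _.
  by rewrite /atoms valK.
have massE A : msum atoms #|I| A = (\sum_i w i * (x i \in A)%:R)%:E.
  rewrite /msum (atomsE (fun m => m A)) -sumEFin. apply: eq_bigr => i _.
  by rewrite /atom /= /mscale/= diracE EFinM.
have mass1 : msum atoms #|I| setT = 1%E.
  rewrite massE; congr (_%:E); rewrite -[RHS]w1; apply: eq_bigr => i _.
  by rewrite in_setT mulr1.
pose rho : probability T R := HB.pack (msum atoms #|I|)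
  (Measure_isProbability.Build _ _ _ (msum atoms #|I|) mass1).
exists rho; split => [A _|D g mD mg g0 Dx]; first exact: massE.
have mgE : measurable_fun D (fun y => (g y)%:E) by exact/measurable_EFinP.
rewrite /Rintegral ge0_integral_measure_sum//.
rewrite (atomsE (fun m => \int[m]_(y in D) (g y)%:E)%E).
rewrite (_ : (\sum_i _)%E = (\sum_i w i * g (x i))%:E)//.
rewrite -sumEFin; apply: eq_bigr => i _.
rewrite /atom ge0_integral_mscale// integral_dirac// diracE mem_set//.
by rewrite mul1e EFinM.
Qed.

(** * Product measures *)

Lemma sum_bernoulli_law (R : realType) (n : nat) (x : vec R n) :
  \sum_X bernoulli_law x X = 1.
Proof.
pose F (i : 'I_n) (b : bool) : R := if b then tnth x i else 1 - tnth x i.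
transitivity (\prod_(i < n) \sum_b F i b).
  rewrite bigA_distr_bigA/= (reindex (@finfun_of_tuple bool n)); last first.
    apply: onW_bij; exists (@tuple_of_finfun bool n).
    - exact: finfun_of_tupleK.
    - exact: tuple_of_finfunK.
  apply: eq_bigr => X _; apply: eq_bigr => i _.
  by rewrite /F ffunE.
by rewrite big1// => i _; rewrite big_bool /F/= addrC subrK.
Qed.

Lemma bernoulli_law_ge0 (R : realType) (n : nat) (x : vec R n) (X : config n) :
  unit_cube R n x -> 0 <= bernoulli_law x X.
Proof.
move=> x01; apply: prodr_ge0 => i _; have /andP[x0 x1] := x01 i.
by case: ifP => // _; rewrite subr_ge0.
Qed.

Lemma measurable_bernoulli_law (R : realType) (n : nat) (X : config n)
    (D : set (vec R n)) :
  measurable_fun D (fun x : vec R n => bernoulli_law x X : R).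
Proof.
apply: measurable_funTS; apply: measurable_prod => i _.
case: (tnth X i); first exact: measurable_tnth.
by apply: measurable_funB => //; exact: measurable_tnth.
Qed.

Lemma bernoulli_law_permute (R : realType) (n : nat) (c : R) (s : {perm 'I_n})
    (X : config n) :
  bernoulli_law ([tuple c | i < n] : vec R n) (permute s X)
  = bernoulli_law ([tuple c | i < n] : vec R n) X.
Proof.
rewrite /bernoulli_law [RHS](reindex_inj (@perm_inj _ s)).
by apply: eq_bigr => i _; rewrite !tnth_mktuple.
Qed.

Lemma bernoulli_balance (R : realType) (n : nat) (x : vec R n) (X : config n)
    (i : 'I_n) :
  bernoulli_law x (set_coord X i true) * (1 - tnth x i)
  = bernoulli_law x (set_coord X i false) * tnth x i.
Proof.
rewrite /bernoulli_law (bigD1 i)//= [in RHS](bigD1 i)//= !tnth_set_coord eqxx.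
rewrite mulrAC [RHS]mulrAC [(1 - _) * _]mulrC; congr (_ * _).
by apply: eq_bigr => j /negPf ji; rewrite !tnth_set_coord ji.
Qed.

Lemma drift_bernoulli (R : realType) (n : nat) (x : vec R n) (X : config n) :
  drift (fun _ : config n => tnth x) X = (ones X)%:R - \sum_i tnth x i.
Proof. by rewrite /drift sumrB -ones_sum. Qed.

(** From the second to the first absolute moment, by
[|D| <= (D^2 / s + s) / 2]. *)
Lemma sum_abs_le (R : realType) (I : finType) (w D : I -> R) (s : R) :
  (forall i, 0 <= w i) -> \sum_i w i = 1 -> 0 < s ->
  \sum_i w i * D i ^+ 2 <= s ^+ 2 -> \sum_i w i * `|D i| <= s.
Proof.
move=> w0 w1 s0 sq.
apply: (@le_trans _ _ (\sum_i w i * ((2 * s)^-1 * D i ^+ 2 + s / 2))).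
  apply: ler_sum => i _; rewrite ler_wpM2l//.
  rewrite -(ler_pM2l (_ : 0 < 2 * s)) ?mulr_gt0// -[D i ^+ 2]real_normK ?num_real//.
  rewrite [leRHS](_ : _ = `|D i| ^+ 2 + s ^+ 2); last by field; rewrite gt_eqF.
  have := sqr_ge0 (`|D i| - s); nra.
under eq_bigr do rewrite mulrDr mulrCA.
rewrite big_split/= -mulr_sumr -mulr_suml w1 mul1r.
apply: (@le_trans _ _ ((2 * s)^-1 * s ^+ 2 + s / 2)).
  by rewrite lerD2r ler_wpM2l// invr_ge0 mulr_ge0// ltW.
by rewrite le_eqVlt; apply/orP; left; apply/eqP; field; rewrite gt_eqF.
Qed.

(** For a product law the conditional probability [u] is constant, so flipping
a coordinate changes the drift by exactly 1. *)
Lemma bernoulli_mean_deviation (R : realType) (n : nat) (x : vec R n) :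
  (0 < n)%N -> unit_cube R n x ->
  \sum_W bernoulli_law x W * `|(ones W)%:R - \sum_i tnth x i| <= Num.sqrt n%:R.
Proof.
move=> n0 x01; apply: sum_abs_le.
- by move=> W; exact: bernoulli_law_ge0.
- exact: sum_bernoulli_law.
- by rewrite sqrtr_gt0 ltr0n.
rewrite sqr_sqrtr// -[leRHS]mul1r.
under eq_bigr do rewrite -drift_bernoulli.
apply: second_moment_drift => //.
- by move=> W; exact: bernoulli_law_ge0.
- exact: sum_bernoulli_law.
- by move=> X i; exact: bernoulli_balance.
move=> X i; rewrite !drift_bernoulli opprB addrA subrK ones_set_coord -natr1.
by rewrite addrAC subrr add0r normr1.
Qed.

(** * The subgraph counting function *)

Lemma subgraph_count_permute (R : realType) (l n : nat) (m : 'I_l -> nat)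
    (alpha : 'I_l -> R) (p : R) (s : {perm 'I_n}) (X : config n) :
  subgraph_count n m alpha p (permute s X) = subgraph_count n m alpha p X.
Proof.
have normE (Y : config n) : l1norm (tnth (weight Y)) = (ones Y)%:R :> R.
  by rewrite ones_sum; apply: eq_bigr => i _; rewrite tnth_mktuple normr_nat.
rewrite /subgraph_count !normE ones_permute; congr (_ * _ + _).
by apply: eq_bigr => q _; rewrite !distinct_sum_weight ones_permute.
Qed.

Definition density {R : realType} {n : nat} (X : config n) : vec R n :=
  [tuple (ones X)%:R / n%:R | i < n].

Lemma density_unit_cube (R : realType) (n : nat) (X : config n) :
  unit_cube R n (density X).
Proof.
move=> i; rewrite tnth_mktuple.
have n0 : (0 < n)%N by exact: leq_ltn_trans (ltn_ord i).
by rewrite divr_ge0//= ler_pdivrMr ?ltr0n// mul1r ler_nat ones_le.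
Qed.

Lemma sum_density (R : realType) (n : nat) (X : config n) :
  (0 < n)%N -> \sum_i tnth (density X : vec R n) i = (ones X)%:R.
Proof.
move=> n0; under eq_bigr do rewrite tnth_mktuple.
by rewrite sumr_const card_ord -[LHS]mulr_natr divfK// pnatr_eq0 -lt0n.
Qed.

Section subgraph_counting.
Variables (R : realType) (n l : nat) (m : 'I_l -> nat) (alpha : 'I_l -> R) (p : R).
Hypotheses (n_gt0 : (0 < n)%N) (m_ge2 : forall q, (2 <= m q)%N).

Let C := C_alpha m alpha p.
Let f := subgraph_count n m alpha p.
Let u (X : config n) (i : 'I_n) : R := (1 + tanh (discrete_grad f X i)) / 2.

Let C_ge2 : 2 <= C. Proof. exact: C_alpha_ge2. Qed.

Let nR_gt0 : 0 < n%:R :> R. Proof. by rewrite ltr0n. Qed.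

Let uE (X : config n) (i : 'I_n) :
  u X i = (1 + tanh (grad n m alpha p (weight X) i)) / 2.
Proof. by rewrite /u grad_weight// => q; exact: ltnW. Qed.

(** Flipping [X_i] changes [X_i] by 1, leaves [u_i] unchanged, and moves each
of the other [u_j] by at most [2 C / n]. *)
Let drift_lipschitz (X : config n) (i : 'I_n) :
  `|drift u (set_coord X i true) - drift u (set_coord X i false)| <= 3 * C.
Proof.
rewrite /drift -sumrB; apply: le_trans (ler_norm_sum _ _ _) _.
apply: (@le_trans _ _ (\sum_j ((j == i)%:R + 2 * (C * n%:R^-1)))).
  apply: ler_sum => j _; rewrite !tnth_set_coord.
  case: (eqVneq j i) => [->|ji].
    rewrite /u /discrete_grad !set_coordK opprB addrA subrK subr0.
    by rewrite normr1 lerDl !mulr_ge0 ?invr_ge0// (le_trans _ C_ge2).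
  rewrite add0r opprB addrC addrA subrK !uE distrC.
  apply: le_trans (half_tanh_lipschitz _ _) _.
  by rewrite ler_wpM2l// grad_weight_lipschitz.
rewrite big_split/= sumr_const card_ord (bigD1 i)//= eqxx big1; last first.
  by move=> j /negPf ->.
rewrite -[_ *+ n]mulr_natr addr0 -!mulrA mulVf ?gt_eqF// mulr1.
by rewrite mulr1n; have := C_ge2; lra.
Qed.

Lemma gibbs_drift_second_moment :
  \sum_X gibbs f X * drift u X ^+ 2 <= 3 * C * n%:R.
Proof.
apply: second_moment_drift.
- exact: gibbs_ge0.
- exact: sum_gibbs.
- by move=> X i; exact: half_tanh_ge0_le1.
- by move=> X i b; rewrite /u /discrete_grad !set_coordK.
- by move=> X i; exact: gibbs_balance.
- exact: drift_lipschitz.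
Qed.

(** At a constant vector all coordinates of the gradient agree, so the terms of
the 1-norm have a common sign and the norm is the absolute value of
[N - sum_i v_i], which differs from the drift [N - sum_i u_i] by the effect
of replacing [X] by [N / n] in the gradient. *)
Lemma density_fixed_point_error (X : config n) :
  l1norm (fun i => tnth (density X) i
                   - (1 + tanh (grad n m alpha p (density X) i)) / 2)
    <= `|drift u X| + 2 * C * Num.sqrt n%:R.
Proof.
set v := fun i => (1 + tanh (grad n m alpha p (density X) i)) / 2.
pose i0 := Ordinal n_gt0.
have vE i : v i = v i0.
  rewrite /v /grad; congr ((1 + tanh (_ + _)) / 2).
  by apply: eq_bigr => q _; rewrite !punctured_sum_const.
have -> : l1norm (fun i => tnth (density X) i - v i)
    = `|\sum_i (tnth (density X) i - v i)|.
  rewrite /l1norm; under eq_bigr do rewrite vE tnth_mktuple.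
  under [in RHS]eq_bigr do rewrite vE tnth_mktuple.
  by rewrite !sumr_const normrMn.
rewrite sumrB sum_density// ones_sum.
have -> : \sum_i (tnth X i)%:R - \sum_i v i = drift u X + \sum_i (u X i - v i).
  by rewrite /drift !sumrB addrA subrK.
apply: le_trans (ler_normD _ _) _; rewrite lerD2l.
apply: le_trans (ler_norm_sum _ _ _) _.
apply: (@le_trans _ _ (\sum_(i < n) 2 * (C * (Num.sqrt n%:R)^-1))).
  apply: ler_sum => i _; rewrite uE; apply: le_trans (half_tanh_lipschitz _ _) _.
  by rewrite ler_wpM2l// grad_weight_const_dist.
rewrite sumr_const card_ord -[_ *+ n]mulr_natr -!mulrA !ler_wpM2l//.
  by rewrite (le_trans _ C_ge2).
rewrite -[X in _ * X](@sqr_sqrtr _ n%:R)// expr2 mulKf//.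
by rewrite gt_eqF// sqrtr_gt0.
Qed.

End subgraph_counting.

Theorem theorem4p1 (R : realType) (n l : nat) (m : 'I_l -> nat)
    (alpha : 'I_l -> R) (p : R)
    (n_ge1 : (1 <= n)%N) (l_ge1 : (1 <= l)%N)
    (m_ge2 : forall q, (2 <= m q)%N) (m_inj : injective m)
    (p_gt0 : 0 < p) (p_lt1 : p < 1) :
  exists rho : probability (vec R n) R,
    [/\ rho (unit_cube R n) = 1%E,
        is_mixture rho
          (80 * C_alpha m alpha p `^ (1 / 4) * n%:R `^ (- (1 / 8)))
          (gibbs (subgraph_count n m alpha p))
      & ((1 - 80 * C_alpha m alpha p `^ (1 / 4) * n%:R `^ (- (1 / 8)))%:E
           <= rho (approx_fixed_points n m alpha p))%E].
Proof.
set f := subgraph_count n m alpha p; set C := C_alpha m alpha p.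
have C2 : 2 <= C by exact: C_alpha_ge2.
have c1 : 1 <= C `^ (1 / 4).
  by rewrite -[leLHS](powRr0 C) ler_powR//; lra.
move: (C `^ (1 / 4)) c1 => c c1.
have nR1 : 1 <= n%:R :> R by rewrite ler1n.
have t1 : 1 <= n%:R `^ (1 / 8) :> R.
  by rewrite -[leLHS](powRr0 n%:R) ler_powR//; lra.
have tX (k : nat) : n%:R `^ (k%:R / 8) = (n%:R `^ (1 / 8)) ^+ k :> R.
  by rewrite -powR_mulrn ?powR_ge0// -powRrM; congr (_ `^ _); lra.
have n_t : n%:R = (n%:R `^ (1 / 8)) ^+ 8 :> R.
  by rewrite -tX divff// powRr1.
have sqrt_t : Num.sqrt n%:R = (n%:R `^ (1 / 8)) ^+ 4 :> R.
  by rewrite -powR12_sqrt// -tX; congr (_ `^ _); lra.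
have n78 : n%:R `^ (7 / 8) = (n%:R `^ (1 / 8)) ^+ 7 :> R by exact: tX.
(* All powers of [n] below are powers of [t = n^(1/8)]. *)
rewrite powRN; set t : R := n%:R `^ (1 / 8) in t1 tX n_t sqrt_t n78 *.
have t0 : 0 < t by lra.
have [rho [rhoE rho_int]] :=
  finite_mixture (T := vec R n) (@density R n) (gibbs_ge0 f) (sum_gibbs f).
have law W : mixture_law rho W = \sum_Z gibbs f Z * bernoulli_law (density Z) W.
  rewrite /mixture_law rho_int//.
  - exact: measurable_unit_cube.
  - exact: measurable_bernoulli_law.
  - by move=> x x01; exact: bernoulli_law_ge0.
  - exact: density_unit_cube.
exists rho; split.
- rewrite rhoE; last exact: measurable_unit_cube.
  congr (_%:E); rewrite -[RHS](sum_gibbs f); apply: eq_bigr => Z _.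
  by rewrite mem_set ?mulr1//; exact: density_unit_cube.
- have [||||| pi [pi_coupling pi_cost]] := @exchangeable_coupling R n
    (mixture_law rho) (gibbs f) (fun W Z => gibbs f Z * bernoulli_law (density Z) W).
  + move=> W Z; rewrite mulr_ge0 ?gibbs_ge0// bernoulli_law_ge0//.
    exact: density_unit_cube.
  + by move=> W; rewrite law.
  + by move=> Z; rewrite -mulr_sumr sum_bernoulli_law mulr1.
  + by move=> s X; rewrite !law; apply: eq_bigr => Z _; rewrite bernoulli_law_permute.
  + by move=> s X; rewrite /gibbs /f subgraph_count_permute.
  exists pi; split => //; rewrite pi_cost exchange_big/=.
  apply: (@le_trans _ _ (Num.sqrt n%:R)).
    rewrite -[leRHS]mul1r -[X in _ <= X * _](sum_gibbs f) mulr_suml; apply: ler_sum => Z _.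
    under eq_bigr do rewrite -mulrA.
    rewrite -mulr_sumr ler_wpM2l ?gibbs_ge0// -(sum_density R Z n_ge1).
    by apply: bernoulli_mean_deviation => //; exact: density_unit_cube.
  rewrite sqrt_t n_t (_ : _ * t ^+ 8 = 80 * c * t ^+ 7); last first.
    by field; rewrite gt_eqF.
  apply: (@le_trans _ _ (t ^+ 7)); first by rewrite ler_weXn2l.
  by rewrite ler_peMl ?exprn_ge0 ?ltW//; lra.
- rewrite rhoE; last exact: measurable_approx_fixed_points.
  rewrite lee_fin lerBlDr -lerBlDl.
  pose u (X : config n) i : R := (1 + tanh (discrete_grad f X i)) / 2.
  have second_moment : \sum_X gibbs f X * drift u X ^+ 2 <= 3 * C * n%:R.
    exact: gibbs_drift_second_moment.
  (* Above [sqrt (n C)] by a factor large enough for Chebyshev's inequality to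
  give a probability of order at most [1 / t], and still of the order of [n^(7/8)]. *)
  pose lambda := C * t ^+ 7.
  have lambda0 : 0 < lambda by rewrite mulr_gt0 ?exprn_gt0//; lra.
  have good X : `|drift u X| <= lambda -> approx_fixed_points n m alpha p (density X).
    move=> S_le; split; first exact: density_unit_cube.
    apply: le_trans (density_fixed_point_error alpha p n_ge1 m_ge2 X) _.
    rewrite -/C -/f -/u n78 sqrt_t.
    have : t ^+ 4 <= t ^+ 7 by rewrite ler_weXn2l.
    move: S_le; rewrite /lambda; move: (`|drift u X|) => S.
    have : 0 < t ^+ 4 by rewrite exprn_gt0.
    move: (t ^+ 4) (t ^+ 7) => a b a0 S_le ab.
    have : C * a <= C * b by rewrite ler_wpM2l//; lra.
    have : C * b <= C ^+ 2 * b by rewrite ler_wpM2r//; [lra|rewrite ler_eXnr//; lra].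
    by nra.
  apply: (@le_trans _ _ (3 * C * n%:R / lambda ^+ 2)).
    rewrite -[X in X - _](sum_gibbs f) -sumrB ler_pdivlMr ?exprn_gt0//.
    apply: le_trans second_moment; rewrite mulr_suml; apply: ler_sum => X _.
    rewrite -{1}[gibbs f X]mulr1 -mulrBr -mulrA ler_wpM2l ?gibbs_ge0//.
    case: (leP `|drift u X| lambda) => [S_le|S_gt].
      by rewrite mem_set ?subrr ?mul0r ?sqr_ge0//; exact: good.
    rewrite -[drift u X ^+ 2]real_normK ?num_real//.
    apply: (@le_trans _ _ (lambda ^+ 2)).
      by rewrite ler_piMl ?sqr_ge0// lerBlDr lerDl.
    by rewrite lerXn2r ?nnegrE// ltW.
  rewrite n_t /lambda (_ : _ / _ = 3 * (C^-1 * (t^-1) ^+ 6)); last first.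
    by field; rewrite !gt_eqF//; lra.
  have : C^-1 <= 1 by rewrite invf_le1; lra.
  have : t^-1 ^+ 6 <= t^-1.
    by rewrite ler_iXnr// ?invr_ge0 ?invf_le1// ltW.
  have : 0 < t^-1 by rewrite invr_gt0.
  have : 0 <= C^-1 by rewrite invr_ge0; lra.
  have : 0 <= t^-1 ^+ 6 by rewrite exprn_ge0// invr_ge0 ltW.
  move: (t^-1) (C^-1) => y z; move: (y ^+ 6) => y6 y60 z0 y0 y6y z1.
  have : z * y6 <= y6 by rewrite ler_piMl.
  have : y <= c * y by rewrite ler_peMl// ltW.
  lra.
Qed.
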